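(* Let $\Pi$ be a program, let $F$ be a CNF formula with $\mathrm{at}(\Pi)\subseteq\mathrm{vars}(F)$, obtained from $\mathrm{comp}(\Pi)$ by a transformation that introduces auxiliary variables (the variables in $\mathrm{vars}(F)\setminus \mathrm{at}(\Pi)$) and for which restriction of assignments to $\mathrm{at}(\Pi)$ is a bijection from the models of $F$ onto the supported models of $\Pi$. Let $\Phi_\Pi$ be an sd-DNNF logically equivalent to $F$ with $\mathrm{vars}(\Phi_\Pi)=\mathrm{vars}(F)$, and let $\mathcal{G}_\Pi$ be its counting graph. Then $\mathrm{val}(\tau(\mathcal{G}_\Pi))=\mathrm{val}(\mathcal{G}_\Pi)$, and $\tau(\mathcal{G}_\Pi)$ can be constructed in time $\mathcal{O}(2\cdot|\Phi_\Pi|)$.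
   Context: Programs. A (propositional logic) program $\Pi$ is a finite set of rules $r$ of the form $a_0\leftarrow a_1,\dots,a_m,\neg a_{m+1},\dots,\neg a_n$ with $0\le m\le n$; $a_1,\dots,a_n$ are atoms and $a_0$ is an atom or the constant $\bot$ (always false; not counted as an atom). Put $H(r)=\{a_0\}$, $B^+(r)=\{a_1,\dots,a_m\}$, $B^-(r)=\{a_{m+1},\dots,a_n\}$; $\mathrm{at}(\Pi)$ is the set of atoms occurring in $\Pi$, and $\mathcal{L}(\Pi)=\mathrm{at}(\Pi)\cup\{\neg a\mid a\in \mathrm{at}(\Pi)\}$. Supported models. The completion $\mathrm{comp}(\Pi)$ is the propositional formula that is the conjunction, over all $a\in \mathrm{at}(\Pi)\cup\{\bot\}$, of $a\leftrightarrow\bigvee_{r\in\Pi,\,H(r)=\{a\}}\big(\bigwedge_{b\in B^+(r)}b\wedge\bigwedge_{c\in B^-(r)}\neg c\big)$ (empty conjunction is $\top$, empty disjunction is $\bot$). A supported model of $\Pi$ is a set $I\subseteq \mathrm{at}(\Pi)$ that, as the truth assignment making exactly the atoms in $I$ true, satisfies $\mathrm{comp}(\Pi)$. sd-DNNF. A formula is in NNF if negation occurs only directly in front of variables and the only other operators are $\wedge,\vee$; it is represented as a rooted DAG whose leaves are labeled with literals and whose inner nodes (with at least two children) are $\wedge$-nodes or $\vee$-nodes. Its size $|\varphi|$ is the number of edges of the DAG, and $\mathrm{vars}(\varphi)$ is the set of variables occurring in it. It is an sd-DNNF if (decomposability) distinct conjuncts of any conjunction share no variables, (decision) each disjunction has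 the form $(x\wedge\psi_1)\vee(\neg x\wedge\psi_2)$ for a variable $x$, and (smoothness) the two disjuncts of each disjunction have the same set of variables. Counting graph. The counting graph $\mathcal{G}(\varphi)$ is the DAG of $\varphi$ with each node $N$ labeled by $\mathrm{val}(N)$: $\mathrm{val}(N)=1$ for literal leaves, the sum of the children's values for $\vee$-nodes, and the product of the children's values for $\wedge$-nodes. $\mathrm{val}(\mathcal{G}(\varphi))$ is the value of the root. Compressed counting graph $\tau(\mathcal{G}_\Pi)$. Traverse the nodes $N$ of $\Phi_\Pi$ bottom-up. A leaf with literal $\ell\in\mathcal{L}(\Pi)$ is kept with its value; a leaf with a literal not in $\mathcal{L}(\Pi)$ is ignored. For an inner node $N$, consider its children that are not ignored (a child that has been absorbed being replaced by the node that replaced it): if there are none, $N$ is ignored; if there is exactly one, $C$, then $N$ is absorbed, i.e. $N$ is removed and replaced by $C$; otherwise $N$ is kept with these remaining children, and its value is the sum ($\vee$-node) or product ($\wedge$-node) of the values of its remaining children. Finally all ignored nodes are removed. $\mathrm{val}(\tau(\mathcal{G}_\Pi))$ is the value of the node representing the root (and is $1$ if nothing remains, which only happens when $\mathrm{at}(\Pi)=\emptyset$). *)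

(* Defs.v *)
From HB Require Import structures.
From mathcomp Require Import all_boot.
From mathcomp Require Import finmap.
From mathcomp Require Import classical_sets functions.

Set Implicit Arguments.
Unset Strict Implicit.
Unset Printing Implicit Defensive.

Local Open Scope fset_scope.
Local Open Scope nat_scope.

Definition var := nat.
Definition assignment := var -> bool.

(** [(x, true)] is the literal x and [(x, false)] is its negation. *)
Definition literal := (var * bool)%type.

Definition lit_eval (v : assignment) (l : literal) : bool := v l.1 == l.2.

Inductive form :=
| FBot
| FVar of var
| FNot of form
| FAnd of seq form
| FOr of seq form
| FIff of form & form.

Fixpoint form_eval (v : assignment) (f : form) : bool :=
  match f with
  | FBot => false
  | FVar x => v x
  | FNot g => ~~ form_eval v g
  | FAnd gs => all (form_eval v) gs
  | FOr gs => has (form_eval v) gs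
  | FIff g h => form_eval v g == form_eval v h
  end.

Definition cnf := seq (seq literal).

Definition cnf_eval (v : assignment) (F : cnf) : bool :=
  all (has (lit_eval v)) F.

Definition cnf_vars (F : cnf) : {fset var} :=
  [fset l.1 | l in flatten F].

(** An assignment to a finite set of variables is given by the set of variables
    that it makes true. *)
Definition assign (I : {fset var}) : assignment := fun x => x \in I.

Definition cnf_models (F : cnf) : set {fset var} :=
  [set M | (M `<=` cnf_vars F)%fset /\ cnf_eval (assign M) F]%classic.

(** The head [None] stands for the constant bottom. *)
Record rule := Rule {
  head : option var;
  pos_body : seq var;
  neg_body : seq var }.

(** Finite sets of rules (and rule bodies) are given by lists; only membership
    in these lists matters below. *)
Definition program := seq rule.

Definition rule_atoms (r : rule) : seq var :=
  seq_of_opt (head r) ++ pos_body r ++ neg_body r.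

Definition atoms (P : program) : {fset var} :=
  [fset a in flatten (map rule_atoms P)].

Definition head_form (h : option var) : form :=
  if h is Some a then FVar a else FBot.

Definition body_form (r : rule) : form :=
  FAnd [:: FAnd (map FVar (pos_body r));
           FAnd [seq FNot (FVar c) | c <- neg_body r]].

Definition completion (P : program) : form :=
  FAnd [seq FIff (head_form h) (FOr [seq body_form r | r <- P & head r == h])
       | h <- None :: map Some (enum_fset (atoms P))].

Definition supported_models (P : program) : set {fset var} :=
  [set I | (I `<=` atoms P)%fset /\ form_eval (assign I) (completion P)]%classic.

Inductive connective := Conj | Disj.

Inductive label (n : nat) :=
| Leaf of literal
| Gate of connective & seq 'I_n.
Arguments Leaf {n}.

Definition children n (l : label n) : seq 'I_n :=
  if l is Gate _ cs then cs else [::].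

(** The nodes are numbered arbitrarily; in particular the numbering is not
    assumed to be a topological one. *)
Record dag (n : nat) := Dag {
  lab : 'I_n -> label n;
  root : 'I_n }.

Definition edge n (L : 'I_n -> label n) : rel 'I_n :=
  [rel v w | w \in children (L v)].

Definition acyclic n (L : 'I_n -> label n) : Prop :=
  forall v w, edge L v w -> ~~ connect (edge L) w v.

Definition rooted_dag n (D : dag n) : Prop :=
  [/\ acyclic (lab D),
      forall v, connect (edge (lab D)) (root D) v &
      forall v o cs, lab D v = Gate o cs -> uniq cs /\ 2 <= size cs].

Definition dag_size n (D : dag n) : nat := \sum_v size (children (lab D v)).

(** Bottom-up evaluation: [f v ts] is the result at [v] given the results [ts]
    at the children of [v]. A path in an acyclic graph has at most [n] nodes, so
    that the recursion depth [n] suffices; see [foldE]. *)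
Fixpoint fold_depth n T (L : 'I_n -> label n) (f : 'I_n -> seq T -> T)
    (k : nat) (v : 'I_n) : T :=
  if k is k'.+1 then f v (map (fold_depth L f k') (children (L v)))
  else f v [::].

Definition fold n T (L : 'I_n -> label n) (f : 'I_n -> seq T -> T) : 'I_n -> T :=
  fold_depth L f n.

Lemma foldE n T (L : 'I_n -> label n) (f : 'I_n -> seq T -> T) (v : 'I_n) :
  acyclic L -> fold L f v = f v (map (fold L f) (children (L v))).
Proof.
move=> acL; pose r v := #|connect (edge L) v|.
have r_lt x y : y \in children (L x) -> r y < r x.
  move=> xy; apply/proper_card/properP; split.
    by apply/fintype.subsetP => z; apply: connect_trans; apply: connect1.
  by exists x; [exact: connect0 | exact: acL].
have r_gt0 x : 0 < r x by apply/card_gt0P; exists x; exact: connect0.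
have stable k k' x : r x <= k -> r x <= k' ->
    fold_depth L f k x = fold_depth L f k' x.
  elim: k k' x => [|k IH] [|k'] x xk xk' //=.
  - by move: (r_gt0 x); rewrite ltnNge xk.
  - by move: (r_gt0 x); rewrite ltnNge xk'.
  congr (f x _); apply/eq_in_map => y xy.
  by apply: IH; rewrite -ltnS; apply: leq_trans (r_lt _ _ xy) _.
have r_le x : r x <= n by rewrite -[X in _ <= X]card_ord max_card.
by rewrite {1}/fold (stable n n.+1) ?leqW.
Qed.

Definition node_eval n (L : 'I_n -> label n) (v : assignment) : 'I_n -> bool :=
  fold L (fun i bs => match L i with
                      | Leaf l => lit_eval v l
                      | Gate Conj _ => all id bs
                      | Gate Disj _ => has id bs
                      end).

Definition node_vars n (L : 'I_n -> label n) : 'I_n -> {fset var} :=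
  fold L (fun i Xs => match L i with
                      | Leaf l => [fset l.1]
                      | Gate _ _ => \bigcup_(X <- Xs) X
                      end).

Definition dag_eval n (D : dag n) (v : assignment) : bool :=
  node_eval (lab D) v (root D).

Definition dag_vars n (D : dag n) : {fset var} := node_vars (lab D) (root D).

Definition decomposable n (D : dag n) : Prop :=
  forall v cs, lab D v = Gate Conj cs ->
  {in cs &, forall c d, c != d ->
    [disjoint node_vars (lab D) c & node_vars (lab D) d]%fset}.

(** Node [c] represents [l /\ psi]. Here [psi] is the conjunction of all children
    of the conjunction [c] other than the leaf [l]; the leaf [l] itself is the
    case where this conjunction is empty (so that x \/ ~ x is a decision). *)
Definition has_conjunct n (D : dag n) (c : 'I_n) (l : literal) : Prop :=
  lab D c = Leaf l \/
  exists cs d, [/\ lab D c = Gate Conj cs, d \in cs & lab D d = Leaf l].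

Definition decision n (D : dag n) : Prop :=
  forall v cs, lab D v = Gate Disj cs ->
  exists c d x b, [/\ cs = [:: c; d],
    has_conjunct D c (x, b) & has_conjunct D d (x, ~~ b)].

Definition smooth n (D : dag n) : Prop :=
  forall v cs, lab D v = Gate Disj cs ->
  {in cs &, forall c d, node_vars (lab D) c = node_vars (lab D) d}.

Definition sd_dnnf n (D : dag n) : Prop :=
  [/\ rooted_dag D, decomposable D, decision D & smooth D].

(** The fields [clabel] and [cval] are meaningful on [cnodes] only. *)
Record cgraph (n : nat) := CGraph {
  cnodes : {set 'I_n};
  clabel : 'I_n -> label n;
  cval : 'I_n -> nat;
  croot : option 'I_n }.

Definition node_val n (L : 'I_n -> label n) : 'I_n -> nat :=
  fold L (fun i ks => match L i with
                      | Leaf _ => 1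
                      | Gate Conj _ => \prod_(k <- ks) k
                      | Gate Disj _ => \sum_(k <- ks) k
                      end).

Definition graph_val n (G : cgraph n) : nat :=
  if croot G is Some r then cval G r else 1.

Definition counting_graph n (D : dag n) : cgraph n :=
  CGraph [set: 'I_n]%SET (lab D) (node_val (lab D)) (Some (root D)).

(** [repl A D v] is [None] if [v] is ignored, [Some v] if [v] is kept, and
    [Some w] with [w != v] if [v] is absorbed and finally replaced by [w]. A
    literal over [A] is one whose variable is in [A]. *)
Definition repl (A : {fset var}) n (D : dag n) : 'I_n -> option 'I_n :=
  fold (lab D) (fun v ws => match lab D v with
                            | Leaf l => if l.1 \in A then Some v else None
                            | Gate _ _ => match pmap id ws with
                                          | [::] => None
                                          | [:: w] => Some w
                                          | _ => Some v
                                          end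
                            end).

Definition tau_label (A : {fset var}) n (D : dag n) (v : 'I_n) : label n :=
  match lab D v with
  | Leaf l => Leaf l
  | Gate o cs => Gate o (pmap (repl A D) cs)
  end.

Definition tau (A : {fset var}) n (D : dag n) : cgraph n :=
  CGraph [set v | repl A D v == Some v]%SET (tau_label A D)
         (node_val (tau_label A D)) (repl A D (root D)).

Definition compiled (P : program) (F : cnf) n (D : dag n) : Prop :=
  [/\ (atoms P `<=` cnf_vars F)%fset,
      set_bij (cnf_models F) (supported_models P) (fun M => (M `&` atoms P)%fset),
      sd_dnnf D,
      forall v : assignment, dag_eval D v = cnf_eval v F &
      dag_vars D = cnf_vars F].

(** Running time is that of while programs over arrays of natural numbers, with
    unit cost for each operation (addition, truncated subtraction, multiplication,
    comparison, array access, assignment, test) *)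

Inductive field := Kind | VarOf | Sign | Degree | First | Child.

Inductive array :=
| In of field
| Out of field
| NodeCount
| RootIn
| Atom
| Present
| Value
| RootOut
| Scratch of nat.

Definition array_eq_dec (a b : array) : {a = b} + {a <> b}.
Proof. by decide equality; decide equality. Defined.

Definition store := array -> nat -> nat.

Definition update (s : store) (a : array) (i k : nat) : store :=
  fun b j => if array_eq_dec b a && (j == i) then k else s b j.

Inductive binop := Add | Sub | Mul | Lt | Eq.

Definition binop_eval (o : binop) (k l : nat) : nat :=
  match o with
  | Add => k + l
  | Sub => k - l
  | Mul => k * l
  | Lt => k < l
  | Eq => k == l
  end.

Inductive expr :=
| Const of nat
| Read of array & expr
| Bin of binop & expr & expr.

Fixpoint expr_eval (s : store) (e : expr) : nat :=
  match e with
  | Const k => k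
  | Read a i => s a (expr_eval s i)
  | Bin o e1 e2 => binop_eval o (expr_eval s e1) (expr_eval s e2)
  end.

Fixpoint expr_cost (e : expr) : nat :=
  match e with
  | Const _ => 1
  | Read _ i => (expr_cost i).+1
  | Bin _ e1 e2 => (expr_cost e1 + expr_cost e2).+1
  end.

Inductive cmd :=
| Skip
| Assign of array & expr & expr
| Seq of cmd & cmd
| If of expr & cmd & cmd
| While of expr & cmd.

(** [exec p s s' t]: started in the store [s], the command [p] terminates in the
    store [s'] after [t] steps. *)
Inductive exec : cmd -> store -> store -> nat -> Prop :=
| ExecSkip s : exec Skip s s 1
| ExecAssign a i e s :
    exec (Assign a i e) s (update s a (expr_eval s i) (expr_eval s e))
      (expr_cost i + expr_cost e).+1
| ExecSeq p q s1 s2 s3 t1 t2 :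
    exec p s1 s2 t1 -> exec q s2 s3 t2 -> exec (Seq p q) s1 s3 (t1 + t2)
| ExecIf e p q s s' t :
    exec (if expr_eval s e != 0 then p else q) s s' t ->
    exec (If e p q) s s' (expr_cost e + t).+1
| ExecWhileStop e p s :
    expr_eval s e = 0 -> exec (While e p) s s (expr_cost e).+1
| ExecWhileStep e p s1 s2 s3 t1 t2 :
    expr_eval s1 e != 0 -> exec p s1 s2 t1 -> exec (While e p) s2 s3 t2 ->
    exec (While e p) s1 s3 (expr_cost e + t1 + t2).+1.

(** The label [l] of the node [v] is stored in the arrays [arr Kind], [arr
    VarOf], ...; the numbers of the children of [v] are the entries of
    [arr Child] starting at position [arr First v]. *)
Definition stores_label (s : store) (arr : field -> array) n (v : 'I_n)
    (l : label n) : Prop :=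
  match l with
  | Leaf (x, b) =>
      [/\ s (arr Kind) v = 0, s (arr VarOf) v = x & s (arr Sign) v = b]
  | Gate o cs =>
      [/\ s (arr Kind) v = (if o is Conj then 1 else 2),
          s (arr Degree) v = size cs &
          forall j, j < size cs ->
            s (arr Child) (s (arr First) v + j) = nth 0 (map val cs) j]
  end.

Definition is_input (a : array) : bool :=
  match a with
  | In _ | NodeCount | RootIn | Atom => true
  | _ => false
  end.

(** [s] is an initial store containing [D] and the table of the set [A]. *)
Definition input_store (A : {fset var}) n (D : dag n) (s : store) : Prop :=
  [/\ s NodeCount 0 = n,
      s RootIn 0 = root D,
      forall x : var, s Atom x = (x \in A),
      forall v : 'I_n, stores_label s In v (lab D v) &
      forall a i, ~~ is_input a -> s a i = 0].

(** The cell 0 of [RootOut] tells whether there is a root; the cell 1 contains its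
    number. *)
Definition output_store n (G : cgraph n) (s : store) : Prop :=
  [/\ forall v : 'I_n, s Present v = (v \in cnodes G),
      forall v : 'I_n, v \in cnodes G ->
        s Value v = cval G v /\ stores_label s Out v (clabel G v) &
      if croot G is Some r then s RootOut 0 = 1 /\ s RootOut 1 = r
      else s RootOut 0 = 0].

(* Main.v *)
From mathcomp Require Import all_boot.
From mathcomp Require Import finmap zify.
From mathcomp Require Import classical_sets functions.
Require Import Defs.

(** Every node of an sd-DNNF is satisfiable, and by decomposability every model
    of a node reachable from the root extends, with one fixed assignment of the
    remaining variables, to a model of the root. The two disjuncts of a decision
    have models that differ, so if a disjunction contained no atom of the program,
    then two models of the CNF would have the same restriction to the atoms. Hence
    only leaves and conjunctions are ignored, and these have the value 1; by
    smoothness a disjunction never loses just one of its disjuncts. So every node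
    has the same value as the node that replaces it.

    The compression is computed by a depth-first search. Each iteration of its
    loop has constant cost and either advances the child pointer of a node, or
    pushes a node, or finishes a node, so there is at most one iteration per edge
    and two per node, and a rooted graph has at most one node more than edges. *)

Set Implicit Arguments.
Unset Strict Implicit.
Unset Printing Implicit Defensive.

(** * Induction and recursion along acyclic graphs *)

(** The number of reachable nodes drops strictly along each edge, since by acyclicity a child does
    not reach its parent. *)
Lemma acyclic_ind n (L : 'I_n -> label n) (P : 'I_n -> Prop) :
  acyclic L -> (forall v, (forall w, w \in children (L v) -> P w) -> P v) ->
  forall v, P v.
Proof.
move=> acL IH v; have [k] := ubnP #|connect (edge L) v|.
elim: k v => // k IHk v vk; apply: IH => w vw; apply: IHk.
rewrite ltnS in vk; apply: leq_trans vk; apply/proper_card/properP; split.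
  by apply/fintype.subsetP => z; apply: connect_trans; apply: connect1.
by exists v; [exact: connect0 | exact: acL].
Qed.

Lemma node_valE n (L : 'I_n -> label n) v :
  acyclic L ->
  node_val L v = match L v with
                 | Leaf _ => 1
                 | Gate Conj cs => \prod_(c <- cs) node_val L c
                 | Gate Disj cs => \sum_(c <- cs) node_val L c
                 end.
Proof.
move=> acL; rewrite {1}/node_val foldE //.
by case: (L v) => //= -[] cs; rewrite big_map.
Qed.

(** * Models of single nodes and their extension to the root *)

Section Semantics.
Variables (n : nat) (D : dag n).
Hypothesis acD : acyclic (lab D).
Let L := lab D.

Lemma node_varsE v :
  node_vars L v = match L v with
                  | Leaf l => [fset l.1]%fset
                  | Gate _ cs => (\bigcup_(c <- cs) node_vars L c)%fset
                  end.
Proof.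
by rewrite {1}/node_vars foldE //; case: (L v) => //= o cs; rewrite big_map.
Qed.

Lemma node_evalE a v :
  node_eval L a v = match L v with
                    | Leaf l => lit_eval a l
                    | Gate Conj cs => all (node_eval L a) cs
                    | Gate Disj cs => has (node_eval L a) cs
                    end.
Proof.
rewrite {1}/node_eval foldE //; case: (L v) => //= -[] cs.
  by rewrite all_map.
by rewrite has_map.
Qed.

Lemma node_vars_child v w :
  w \in children (L v) -> (node_vars L w `<=` node_vars L v)%fset.
Proof.
rewrite (node_varsE v); case: (L v) => //= o cs wcs; exact: bigfcup_sup.
Qed.

Lemma node_vars_connect v w :
  connect (edge L) v w -> (node_vars L w `<=` node_vars L v)%fset.
Proof.
case/connectP => p vp ->; elim: p v vp => [|u p IH] v /=.
  by rewrite fsubset_refl.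
by case/andP => vu /IH; move/fsubset_trans; apply; apply: node_vars_child.
Qed.

Lemma eq_node_eval a b v :
  {in node_vars L v, a =1 b} -> node_eval L a v = node_eval L b v.
Proof.
move: v; apply: (acyclic_ind acD) => v IH ab.
have IHc w : w \in children (L v) -> node_eval L a w = node_eval L b w.
  by move=> vw; apply: IH => // x xw; apply/ab/(fsubsetP (node_vars_child vw)).
rewrite !node_evalE; move: ab IHc; rewrite node_varsE -/L.
case: (L v) => [l | [] cs] /= ab IHc.
- by rewrite /lit_eval ab // inE.
- exact: eq_in_all.
- exact: eq_in_has.
Qed.

Definition splice v (a g : assignment) : assignment :=
  fun x => if x \in node_vars L v then a x else g x.

Lemma node_eval_splice v a g : node_eval L (splice v a g) v = node_eval L a v.
Proof. by apply: eq_node_eval => x xv; rewrite /splice xv. Qed.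

Hypotheses (decD : decomposable D) (disD : decision D).

(** By decomposability the other conjuncts contain no variable of [w] and keep their values under
    [g]; in a disjunction [w] alone suffices. *)
Lemma node_eval_splice_child v w a g :
  w \in children (L v) -> node_eval L a w -> node_eval L g v ->
  node_eval L (splice w a g) v.
Proof.
move=> vw aw; rewrite !node_evalE -/L.
case Lv: (L v) vw => [l|o cs] //= wcs.
have ww : node_eval L (splice w a g) w by rewrite node_eval_splice.
case: o Lv => Lv; last by move=> _; apply/hasP; exists w.
move/allP => gcs; apply/allP => d dcs; have [-> //|dw] := eqVneq d w.
rewrite (@eq_node_eval _ g) ?gcs // => x xd.
by rewrite /splice (negbTE (fdisjointP (decD Lv dcs wcs dw) x xd)).
Qed.

Lemma node_satisfiable v : exists a, node_eval L a v.
Proof.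
move: v; apply: (acyclic_ind acD) => v IH.
case Lv: (L v) => [[x b] | [] cs].
- by exists (fun=> b); rewrite node_evalE Lv /lit_eval /=.
- suff [a acs] : exists a, all (node_eval L a) cs.
    by exists a; rewrite node_evalE Lv.
  have : {subset cs <= cs} by [].
  (* Only the list to be satisfied shrinks; decomposability speaks of the full list [cs]. *)
  elim: {1 3}cs => [|c ds IHds] sub; first by exists (fun=> true).
  have [|g gds] := IHds; first by move=> d dds; rewrite sub // inE dds orbT.
  have ccs : c \in cs by rewrite sub ?mem_head.
  have [|a ac] := IH c; first by rewrite -/L Lv.
  exists (splice c a g); rewrite /= node_eval_splice ac /=.
  apply/allP => d dds; have dcs : d \in cs by rewrite sub // inE dds orbT.
  have [-> //|dc] := eqVneq d c; first by rewrite node_eval_splice.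
  rewrite (@eq_node_eval _ g) ?(allP gds) // => x xd.
  by rewrite /splice (negbTE (fdisjointP (decD Lv dcs ccs dc) x xd)).
have [c [d [x [b [csE _ _]]]]] := disD Lv.
have [|a ac] := IH c; first by rewrite -/L Lv csE mem_head.
by exists a; rewrite node_evalE Lv csE /= ac.
Qed.

(** Along a path from the root, the context of a node is that of its predecessor, completed by a
    model of this predecessor. *)
Lemma node_eval_context v :
  connect (edge L) (root D) v ->
  exists g, forall a, node_eval L a v -> dag_eval D (splice v a g).
Proof.
case/connectP => p; elim/last_ind: p v => [|p w IH] v.
  (* At the root every relevant variable is read from [a], so any context will do. *)
  by move=> _ -> /=; exists xpredT => a; rewrite /dag_eval node_eval_splice.
rewrite rcons_path last_rcons => /andP[rp uw] ->.
set u := last _ _ in uw.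
have [g gP] := IH u rp (erefl _); have [g0 g0P] := node_satisfiable u.
exists (splice u g0 g) => a aw.
(* The two nestings agree, as the variables of [w] are among those of [u]. *)
have -> : dag_eval D (splice w a (splice u g0 g))
    = dag_eval D (splice u (splice w a g0) g).
  apply: eq_node_eval => x _; rewrite /splice.
  have := fsubsetP (node_vars_child uw) x; rewrite -/L.
  by case: (x \in node_vars L w) => [-> |].
exact/gP/node_eval_splice_child.
Qed.

Lemma has_conjunct_vars c l :
  has_conjunct D c l -> l.1 \in node_vars L c.
Proof.
case=> [Lc | [cs [d [Lc dcs Ld]]]]; first by rewrite node_varsE /L Lc inE.
apply: (fsubsetP (@node_vars_child c d _)); first by rewrite /L Lc.
by rewrite node_varsE /L Ld inE.
Qed.

Lemma has_conjunct_eval c l a :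
  has_conjunct D c l -> node_eval L a c -> a l.1 = l.2.
Proof.
case=> [Lc | [cs [d [Lc dcs Ld]]]]; rewrite node_evalE /L Lc.
  by move/eqP.
by move/allP/(_ d dcs); rewrite node_evalE /L Ld => /eqP.
Qed.

End Semantics.

(** * The replacement map and the compressed graph *)

Lemma pmap_id_map (S U : Type) (f : S -> option U) s :
  pmap id (map f s) = pmap f s.
Proof. by elim: s => //= x s ->. Qed.

Section Replacement.
Variables (A : {fset var}) (n : nat) (D : dag n).
Hypothesis acD : acyclic (lab D).
Let L := lab D.
Let T := tau_label A D.

Lemma replE v :
  repl A D v = match L v with
               | Leaf l => if l.1 \in A then Some v else None
               | Gate _ cs => match pmap (repl A D) cs with
                              | [::] => None
                              | [:: w] => Some w
                              | _ => Some v
                              end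
               end.
Proof.
rewrite {1}/repl foldE //= -/L.
by case: (L v) => //= o cs; rewrite pmap_id_map.
Qed.

Lemma repl_connect v w : repl A D v = Some w -> connect (edge L) v w.
Proof.
move: v w; apply: (acyclic_ind acD) => v IH w; rewrite replE -/L.
case Lv: (L v) IH => [l|o cs] IH; first by case: ifP => // _ [<-].
case ws: (pmap _ cs) => [|u [|? ?]] // [<-] //.
have: u \in pmap (repl A D) cs by rewrite ws mem_head.
rewrite mem_pmap => /mapP[c ccs cu].
have vc : c \in children (lab D v) by rewrite -/L Lv.
exact: connect_trans (connect1 vc) (IH c vc u (esym cu)).
Qed.

Lemma tau_edge v w :
  edge T v w -> exists2 c, edge L v c & connect (edge L) c w.
Proof.
rewrite /edge /= /T /tau_label -/L; case Lv: (L v) => [l|o cs] //=.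
rewrite mem_pmap => /mapP[c ccs /esym cw].
by exists c; last exact: repl_connect.
Qed.

(** Each edge of the compressed graph stems from a nonempty path of the original one, because a
    child is replaced by a node reachable from it. *)
Lemma tau_acyclic : acyclic T.
Proof.
have sub : subrel (connect (edge T)) (connect (edge L)).
  apply: connect_sub => v w /tau_edge[c vc cw].
  exact: connect_trans (connect1 vc) cw.
move=> v w /tau_edge[c vc cw]; apply/negP => /sub wv.
by have /negP[] := acD vc; apply: connect_trans wv.
Qed.

Lemma tau_valE v :
  node_val T v = match L v with
                 | Leaf _ => 1
                 | Gate Conj cs => \prod_(w <- pmap (repl A D) cs) node_val T w
                 | Gate Disj cs => \sum_(w <- pmap (repl A D) cs) node_val T w
                 end.
Proof.
rewrite node_valE; last exact: tau_acyclic.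
have -> : T v = match L v with
                | Leaf l => Leaf l
                | Gate o cs => Gate o (pmap (repl A D) cs)
                end by [].
by case: (L v) => [l|[] cs].
Qed.

(** A gate is ignored exactly if all its children are. In this form smoothness applies to ignored
    nodes. *)
Lemma repl_eq_None v :
  (repl A D v == None) = [disjoint node_vars L v & A]%fset.
Proof.
move: v; apply: (acyclic_ind acD) => v IH; rewrite replE node_varsE // -/L.
case Lv: (L v) IH => [l|o cs] IH; first by rewrite fdisjoint1X; case: ifP.
have -> : [disjoint \bigcup_(c <- cs) node_vars L c & A]%fset
    = all (fun c => repl A D c == None) cs.
  apply/fdisjointP/allP => [dis c ccs | dis x].
    rewrite IH /= -/L ?Lv //; apply/fdisjointP => x xc; apply: dis.
    by apply: (fsubsetP (bigfcup_sup _ ccs _)).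
  case/bigfcupP => c /andP[ccs _].
  by move: (dis c ccs); rewrite IH /= -/L ?Lv // => /fdisjointP; apply.
have -> : all (fun c => repl A D c == None) cs = nilp (pmap (repl A D) cs).
  by elim: cs {Lv IH} => //= c cs ->; case: (repl A D c).
by case: (pmap _ cs) => [|? [|? ?]].
Qed.

End Replacement.

(** * Preservation of values *)

Section Value.
Variables (A : {fset var}) (F : cnf) (n : nat) (D : dag n).
Hypothesis sdD : sd_dnnf D.
Let L := lab D.
Let T := tau_label A D.
Hypotheses (evalD : forall v, dag_eval D v = cnf_eval v F)
  (varsD : dag_vars D = cnf_vars F).
Hypothesis injF :
  forall M N, cnf_models F M -> cnf_models F N -> (M `&` A = N `&` A)%fset -> M = N.

Let acD : acyclic L. Proof. by case: sdD => -[]. Qed.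

(** Models of the two disjuncts, put into the same context, differ at the decision variable [x].
    Without variables from [A] below [v] they would agree on [A], against injectivity. *)
Lemma repl_disj v cs : L v = Gate Disj cs -> repl A D v <> None.
Proof.
move=> Lv /eqP; rewrite repl_eq_None // => /fdisjointP dis.
have [[_ rootD _] decD disD _] := sdD.
have [c [d [x [b [csE cx dx]]]]] := disD _ _ Lv.
have [g gP] := node_eval_context acD decD disD (rootD v).
have vc : c \in children (L v) by rewrite Lv csE mem_head.
have vd : d \in children (L v) by rewrite Lv csE !inE eqxx orbT.
have [a ac] := node_satisfiable acD decD disD c.
have [a' ad] := node_satisfiable acD decD disD d.
have va : node_eval L a v by rewrite node_evalE // -/L Lv csE /= ac.
have va' : node_eval L a' v by rewrite node_evalE // -/L Lv csE /= ad orbT.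
(* The model as a set, cut down to the variables of [F] as [cnf_models] demands. *)
pose M (e : assignment) := [fset y in dag_vars D | splice D v e g y]%fset.
have inM e y : (y \in M e) = (y \in dag_vars D) && splice D v e g y.
  by rewrite !inE.
have MF e : node_eval L e v -> cnf_models F (M e).
  move=> /gP ge; split.
    by apply/fsubsetP => y; rewrite inM -varsD => /andP[].
  rewrite -evalD /dag_eval -(@eq_node_eval _ _ acD (splice D v e g)) // => y yD.
  by rewrite /assign inM [y \in dag_vars D]yD.
have MA : (M a `&` A = M a' `&` A)%fset.
  apply/fsetP => y; rewrite !inE; have [yA|] := boolP (y \in A); last by rewrite !andbF.
  by rewrite /splice; case: ifP => // /dis; rewrite yA.
have /fsetP/(_ x) := injF (MF a va) (MF a' va') MA.
have xv : x \in node_vars L v.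
  exact: (fsubsetP (node_vars_child acD vc)) (has_conjunct_vars acD cx).
have xD : x \in dag_vars D.
  exact: (fsubsetP (node_vars_connect acD (rootD v))).
rewrite !inM xD /splice xv (has_conjunct_eval acD cx ac).
by rewrite (has_conjunct_eval acD dx ad) /=; case: b {cx dx}.
Qed.

(** The default 1 is the value of an ignored node: by [repl_disj] such a node is a leaf or a
    conjunction of ignored nodes. *)
Lemma tau_node_val v : oapp (node_val T) 1 (repl A D v) = node_val L v.
Proof.
have [_ decD disD smD] := sdD.
move: v; apply: (acyclic_ind acD) => v IH; rewrite node_valE // -/L replE // -/L.
case Lv: (L v) => [l|o cs].
  by case: ifP => //= _; rewrite tau_valE // -/L Lv.
case: o Lv => Lv.
  have -> : \prod_(c <- cs) node_val L c
      = \prod_(w <- pmap (repl A D) cs) node_val T w.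
    have: {subset cs <= children (L v)} by rewrite Lv.
    elim: cs {Lv} => [|c cs IHcs] sub /=; first by rewrite !big_nil.
    rewrite big_cons IHcs; last by move=> d dcs; rewrite sub // inE dcs orbT.
    rewrite -IH ?sub ?mem_head //.
    by case: (repl A D c) => [w|] /=; rewrite ?big_cons ?mul1n.
  case ws: (pmap _ cs) => [|w [|w' ws']] /=; rewrite ?big_nil ?big_seq1 //.
  by rewrite tau_valE // -/L Lv ws.
have [c [d [x [b [csE cx dx]]]]] := disD _ _ Lv.
(* By smoothness both disjuncts are ignored or neither is; [repl_disj] excludes the former, so both
   summands remain. *)
have cd : (repl A D c == None) = (repl A D d == None).
  by rewrite !repl_eq_None // (smD _ _ Lv c d) // csE !inE eqxx ?orbT.
have := repl_disj Lv; rewrite replE // -/L Lv csE !big_cons big_nil addn0.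
rewrite -!IH ?Lv ?csE ?inE ?eqxx ?orbT //=; move: cd.
case cw: (repl A D c) => [w|]; case dw: (repl A D d) => [w'|] //= _ _.
by rewrite tau_valE // -/L Lv csE /= cw dw /= !big_cons big_nil addn0.
Qed.

End Value.

Lemma compiled_graph_val P F n (D : dag n) :
  compiled P F D -> graph_val (tau (atoms P) D) = graph_val (counting_graph D).
Proof.
case=> _ [_ injF _] sdD evalD varsD; rewrite /graph_val /=.
rewrite -(@tau_node_val (atoms P) F) //.
by move=> M N MF NF; apply: injF; apply/mem_set.
Qed.

(** * Running time of loop-free commands and of loops *)

Fixpoint loop_free (p : cmd) : bool :=
  match p with
  | Seq q r | If _ q r => loop_free q && loop_free r
  | While _ _ => false
  | _ => true
  end.

Fixpoint run (p : cmd) (s : store) : store :=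
  match p with
  | Assign a i e => update s a (expr_eval s i) (expr_eval s e)
  | Seq q r => run r (run q s)
  | If e q r => if expr_eval s e != 0 then run q s else run r s
  | _ => s
  end.

Fixpoint cost (p : cmd) : nat :=
  match p with
  | Assign _ i e => (expr_cost i + expr_cost e).+1
  | Seq q r => cost q + cost r
  | If e q r => (expr_cost e + maxn (cost q) (cost r)).+1
  | _ => 1
  end.

Lemma exec_run p s :
  loop_free p -> exists2 t, exec p s (run p s) t & t <= cost p.
Proof.
elim: p s => //= [|a i e|q IHq r IHr|e q IHq r IHr] s.
- by exists 1; first exact: ExecSkip.
- by exists (expr_cost i + expr_cost e).+1; first exact: ExecAssign.
- case/andP => /(IHq s)[t qt tq] /(IHr (run q s))[t' rt tr].
  by exists (t + t'); [exact: ExecSeq qt rt | exact: leq_add].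
case/andP => /(IHq s)[t qt tq] /(IHr s)[t' rt tr].
case: ifP => es.
  exists (expr_cost e + t).+1; first by apply: ExecIf; rewrite es.
  by rewrite ltnS leq_add2l leq_max tq.
exists (expr_cost e + t').+1; first by apply: ExecIf; rewrite es.
by rewrite ltnS leq_add2l leq_max tr orbT.
Qed.

(** The decreasing potential bounds the number of iterations; the last summand pays for the final,
    failing test. *)
Lemma exec_while e p (I : store -> Prop) (pot : store -> nat) s :
  loop_free p ->
  (forall s, I s -> expr_eval s e != 0 ->
     I (run p s) /\ pot (run p s) < pot s) ->
  I s ->
  exists s' t, [/\ exec (While e p) s s' t, I s', expr_eval s' e = 0 &
    t <= (expr_cost e + cost p).+1 * pot s + (expr_cost e).+1].
Proof.
move=> lfp step; have [k] := ubnP (pot s); elim: k s => // k IH s sk Is.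
have [es|es] := eqVneq (expr_eval s e) 0.
  exists s, (expr_cost e).+1; split=> //; first exact: ExecWhileStop.
  exact: leq_addl.
have [Is' lt_pot] := step s Is es.
have [t pt tp] := exec_run s lfp.
have [|s' [t' [wt Is'' es' t'P]]] := IH _ _ Is'; first exact: leq_trans lt_pot sk.
exists s', (expr_cost e + t + t').+1; split=> //; first exact: ExecWhileStep pt wt.
have {}tp : (expr_cost e + t).+1 <= (expr_cost e + cost p).+1.
  by rewrite ltnS leq_add2l.
rewrite -addSn; apply: leq_trans (leq_add tp t'P) _.
by rewrite addnA leq_add2r -mulnS leq_mul2l lt_pot orbT.
Qed.

(** * The search program *)

(** The stack of the search is a linked list: [Cur 0] is its top and [Parent]
    leads from a node to the one below it. [Mark v] is 0, 1 or 2 if [v] is new, on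
    the stack or finished, and [Ptr v] is the number of children of [v] that have
    been absorbed. [Rep v] is 0 if [v] is ignored and [w.+1] if [w] replaces [v]. *)
Local Notation Cur := (Scratch 0).
Local Notation Parent := (Scratch 1).
Local Notation Mark := (Scratch 2).
Local Notation Ptr := (Scratch 3).
Local Notation Rep := (Scratch 4).

Definition cur : expr := Read Cur (Const 0).
Definition at_cur (a : array) : expr := Read a cur.
Definition cur_child : expr :=
  Read (In Child) (Bin Add (at_cur (In First)) (at_cur Ptr)).
(** A node has at most [n] children, so that the positions [v * n + j] with [j < n]
    are disjoint for distinct [v]. *)
Definition slot (e : expr) : expr :=
  Bin Add (Bin Mul cur (Read NodeCount (Const 0))) e.
Definition succ (e : expr) : expr := Bin Add e (Const 1).

(** As [Value] is initially 0, a product is started when the output degree is 0. *)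
Definition absorb_child : cmd :=
  Seq (Assign Value cur
        (Bin Add
          (Bin Mul (Bin Eq (at_cur (In Kind)) (Const 1))
            (Bin Mul (Bin Add (at_cur Value)
                              (Bin Eq (at_cur (Out Degree)) (Const 0)))
                     (Read Value cur_child)))
          (Bin Mul (Bin Eq (at_cur (In Kind)) (Const 2))
            (Bin Add (at_cur Value) (Read Value cur_child)))))
  (Seq (Assign (Out Child) (slot (at_cur (Out Degree)))
         (Bin Sub (Read Rep cur_child) (Const 1)))
       (Assign (Out Degree) cur (succ (at_cur (Out Degree))))).

Definition push_child : cmd :=
  Seq (Assign Parent cur_child cur)
  (Seq (Assign Mark cur_child (Const 1))
       (Assign Cur (Const 0) cur_child)).

(** Tests evaluate to 0 or 1, so products with them replace case distinctions. In [Rep] a leaf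
    contributes through the first summand alone, its output degree being 0; a gate with one
    remaining child takes the entry of its first slot. *)
Definition finish_cur : cmd :=
  Seq (Assign Rep cur
        (Bin Add (Bin Mul (Bin Eq (at_cur (In Kind)) (Const 0))
                   (Bin Mul (Read Atom (at_cur (In VarOf))) (succ cur)))
        (Bin Add (Bin Mul (Bin Lt (Const 1) (at_cur (Out Degree))) (succ cur))
                 (Bin Mul (Bin Eq (at_cur (Out Degree)) (Const 1))
                   (succ (Read (Out Child) (slot (Const 0))))))))
  (Seq (Assign Value cur
         (Bin Add (Bin Mul (at_cur Value) (Bin Lt (Const 0) (at_cur (In Kind))))
                  (Bin Eq (at_cur (In Kind)) (Const 0))))
  (Seq (Assign Present cur (Bin Eq (at_cur Rep) (succ cur)))
  (Seq (Assign (Out Kind) cur (at_cur (In Kind)))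
  (Seq (Assign (Out VarOf) cur (at_cur (In VarOf)))
  (Seq (Assign (Out Sign) cur (at_cur (In Sign)))
  (Seq (Assign (Out First) cur (slot (Const 0)))
  (Seq (Assign Mark cur (Const 2))
       (Assign Cur (Const 0) (at_cur Parent))))))))).

Definition body : cmd :=
  If (Bin Mul (at_cur (In Kind)) (Bin Lt (at_cur Ptr) (at_cur (In Degree))))
    (If (Bin Eq (Read Mark cur_child) (Const 2))
      (Seq (If (Read Rep cur_child) absorb_child Skip)
           (Assign Ptr cur (succ (at_cur Ptr))))
      push_child)
    finish_cur.

Definition unfinished : expr :=
  Bin Lt (Read Mark (Read RootIn (Const 0))) (Const 2).

Definition start : cmd :=
  Seq (Assign Cur (Const 0) (Read RootIn (Const 0)))
      (Assign Mark (Read RootIn (Const 0)) (Const 1)).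

Definition write_root : cmd :=
  Seq (Assign RootOut (Const 0)
        (Bin Lt (Const 0) (Read Rep (Read RootIn (Const 0)))))
      (Assign RootOut (Const 1)
        (Bin Sub (Read Rep (Read RootIn (Const 0))) (Const 1))).

Definition compress : cmd := Seq start (Seq (While unfinished body) write_root).

Arguments update s a i k b j /.

(** Arrays indexed by nodes in which an iteration writes at the current node only. [Mark] and
    [Parent] are written at children, and [Out Child] is indexed by slots. *)
Definition node_array (a : array) : bool :=
  match a with
  | Present | Value | Ptr | Rep => true
  | Out f => if f is Child then false else true
  | _ => false
  end.

(** * The invariant and the potential of the search *)

Section Compress.
Variables (A : {fset var}) (n : nat) (D : dag n) (s0 : store).
Hypotheses (dagD : rooted_dag D) (inD : input_store A D s0).
Let L := lab D.
Let T := tau_label A D.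

Let acD : acyclic L. Proof. by case: dagD. Qed.

Definition code (r : option 'I_n) : nat := if r is Some w then w.+1 else 0.

(** The content of [Value] at a gate once [ws] are multiplied or added; a product not yet started is
    the initial 0, not 1. *)
Definition acc (o : connective) (ws : seq 'I_n) : nat :=
  match o with
  | Conj => if ws is [::] then 0 else \prod_(w <- ws) node_val T w
  | Disj => \sum_(w <- ws) node_val T w
  end.

Lemma acc_rcons o ws w :
  acc o (rcons ws w) = match o with
                       | Conj => (acc o ws + (size ws == 0)) * node_val T w
                       | Disj => acc o ws + node_val T w
                       end.
Proof.
rewrite /acc -cats1; case: o; last by rewrite big_cat big_seq1.
by case: ws => [|u ws] /=; rewrite ?big_seq1 ?mul1n // -cat_cons big_cat big_seq1 /= addn0.
Qed.

Definition kept (s : store) (v : 'I_n) : seq 'I_n :=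
  pmap (repl A D) (take (s Ptr v) (children (L v))).

(** [Value v] is maintained for absorbed nodes, too: there it is the value of the
    replacing node. *)
Record finished (s : store) (v : 'I_n) : Prop := Finished {
  fin_ptr : s Ptr v = size (children (L v));
  fin_rep : s Rep v = code (repl A D v);
  fin_value : forall w, repl A D v = Some w -> s Value v = node_val T w;
  fin_present : s Present v = (repl A D v == Some v);
  fin_kind : s (Out Kind) v = s0 (In Kind) v;
  fin_var : s (Out VarOf) v = s0 (In VarOf) v;
  fin_sign : s (Out Sign) v = s0 (In Sign) v;
  fin_first : s (Out First) v = v * n }.

Record node_inv (s : store) (v : 'I_n) : Prop := NodeInv {
  inv_ptr : s Ptr v <= size (children (L v));
  inv_done : forall c, c \in take (s Ptr v) (children (L v)) -> s Mark c = 2;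
  inv_degree : s (Out Degree) v = size (kept s v);
  inv_child : forall j, j < size (kept s v) ->
    s (Out Child) (v * n + j) = nth 0 (map val (kept s v)) j;
  inv_value : forall o cs, L v = Gate o cs -> s Value v = acc o (kept s v);
  inv_fin : s Mark v = 2 -> finished s v }.

(** From top to bottom the stack follows edges backwards to the root, so each of its nodes reaches
    the current one. *)
Definition on_stack (s : store) (v : 'I_n) (st : seq 'I_n) : Prop :=
  [/\ s Cur 0 = v, uniq (v :: st), last v st = Defs.root D,
      path (fun x y => edge L y x && (s Parent x == y)) v st &
      forall u : 'I_n, (s Mark u == 1) = (u \in v :: st)].

Record inv (s : store) : Prop := Inv {
  inv_input : forall a i, is_input a -> s a i = s0 a i;
  inv_node : forall v, node_inv s v;
  inv_mark : forall v : 'I_n, s Mark v <= 2;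
  inv_stack : s Mark (Defs.root D) = 2 \/ exists v st, on_stack s v st }.

(** Each iteration advances a pointer or raises a mark, so this bounds the iterations left. *)
Definition pot (s : store) : nat :=
  \sum_(v < n) ((size (children (L v)) - s Ptr v) + (2 - s Mark v)).

Lemma size_children v : size (children (L v)) <= n.
Proof.
case Lv: (L v) => [l|o cs] //=; have [_ _ /(_ v o cs Lv)[/card_uniqP <- _]] := dagD.
by rewrite -[X in _ <= X]card_ord max_card.
Qed.

Lemma size_kept s v : size (kept s v) <= s Ptr v.
Proof.
rewrite size_pmap (leq_trans (count_size _ _)) // size_take.
by case: ltnP => // /ltnW.
Qed.

Lemma slot_neq (u v : 'I_n) i j : i < n -> j < n -> u != v -> u * n + i != v * n + j.
Proof.
move=> iN jN; apply: contra_neq => /(congr1 (divn^~ n)).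
have n0 : 0 < n by apply: leq_trans iN.
by rewrite !divnMDl // !divn_small // !addn0 => /val_inj.
Qed.

(** Frame rule for a node whose own entries do not change. Its finished children stay finished, and
    it does not become finished itself, which would require its output. *)
Lemma node_inv_frame (s s' : store) (u : 'I_n) :
  (forall a, node_array a -> s' a u = s a u) ->
  (forall j, j < n -> s' (Out Child) (u * n + j) = s (Out Child) (u * n + j)) ->
  (forall x : 'I_n, s Mark x = 2 -> s' Mark x = 2) ->
  (s' Mark u = 2 -> s Mark u = 2) ->
  node_inv s u -> node_inv s' u.
Proof.
move=> sa sc sm su [p1 p2 p3 p4 p5 p6].
have pE : s' Ptr u = s Ptr u by apply: sa.
have kE : kept s' u = kept s u by rewrite /kept pE.
split; rewrite ?kE ?pE //.
- by move=> c /p2/sm.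
- by rewrite sa.
- move=> j jk; rewrite sc ?p4 //; apply: leq_trans jk _.
  exact: leq_trans (size_kept _ _) (leq_trans p1 (size_children u)).
- by move=> o cs Lu; rewrite sa // (p5 _ _ Lu).
by move=> /su/p6[q1 q2 q3 q4 q5 q6 q7 q8]; split; rewrite ?sa.
Qed.

(** Subtraction in [pot] is truncated, hence the strict bounds on the old pointer or mark. *)
Lemma ltn_pot (s s' : store) (v : 'I_n) :
  (forall u : 'I_n, s Ptr u <= s' Ptr u) ->
  (forall u : 'I_n, s Mark u <= s' Mark u) ->
  (s Ptr v < s' Ptr v) && (s Ptr v < size (children (L v))) ||
    (s Mark v < s' Mark v) && (s Mark v < 2) ->
  pot s' < pot s.
Proof.
move=> lp lm lv; rewrite /pot (bigD1 v) //= [ltnRHS](bigD1 v) //= -addSn leq_add //.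
  case/orP: lv => /andP[lt lt2].
    by rewrite -addSn leq_add ?leq_sub2l ?ltn_sub2l.
  by rewrite -addnS leq_add ?leq_sub2l ?ltn_sub2l.
by apply: leq_sum => u _; rewrite leq_add ?leq_sub2l.
Qed.

Lemma node_array_Cur a : node_array a -> array_eq_dec a Cur = false :> bool.
Proof. by case: a => // -[]. Qed.

Lemma node_array_Mark a : node_array a -> array_eq_dec a Mark = false :> bool.
Proof. by case: a => // -[|[|[]]]. Qed.

Lemma node_array_Parent a : node_array a -> array_eq_dec a Parent = false :> bool.
Proof. by case: a => // -[|[]]. Qed.

Lemma node_array_Child a : node_array a -> array_eq_dec a (Out Child) = false :> bool.
Proof. by case: a => // -[]. Qed.

Lemma neq_val (u v : 'I_n) : u != v -> (val u == val v) = false.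
Proof. by move=> uv; apply: negbTE. Qed.

(** * Preservation of the invariant by one iteration *)

Lemma finish_cur_inv s v st :
  inv s -> on_stack s v st -> s Ptr v = size (children (L v)) ->
  inv (run finish_cur s) /\ pot (run finish_cur s) < pot s.
Proof.
move=> [si sn sm _] [Ec uq lst pth mk] pE.
have [N0 _ At lab0 _] := inD; have NE : s NodeCount 0 = n by rewrite si.
have mv : s Mark v = 1 by apply/eqP; rewrite mk mem_head.
have [_ p2 p3 p4 p5 _] := sn v.
set s' := run finish_cur s.
have mE (u : 'I_n) : s' Mark u = if u == v then 2 else s Mark u by rewrite /s' /= Ec.
have ptrE (u : 'I_n) : s' Ptr u = s Ptr u by [].
split; last first.
  apply: (@ltn_pot s s' v) => [//|u|]; last by rewrite mE eqxx mv orbT.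
  by rewrite mE; case: eqP => [->|]; rewrite ?mv.
split; last 2 first.
- by move=> u; rewrite mE; case: ifP.
(* With nothing below it on the stack, [v] is the root and the search ends; otherwise its parent
   becomes current. *)
- case: st uq lst pth mk => [|w st] uq lst pth mk.
    by left; rewrite -lst mE eqxx.
  right; exists w, st; move: pth uq => /= /andP[/andP[vw /eqP Pv] pth] /and3P[vst wst ust].
  split=> //; first by rewrite /s' /= Ec.
    by rewrite /= wst ust.
  move=> u; rewrite mE; have [->|uv] := eqVneq u v; first exact/esym/negbTE.
  by rewrite mk inE (negbTE uv).
- by move=> a i ia; rewrite -si // /s' /=; case: a ia => // -[].
move=> u; have [->{u}|uv] := eqVneq u v; last first.
  apply: (node_inv_frame (s := s)) => //.
  - by move=> a na; rewrite /s' /= Ec node_array_Cur //= (neq_val uv) !andbF.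
  - by move=> x x2; rewrite mE x2 if_same.
  - by rewrite mE (negbTE uv).
have kE : kept s' v = kept s v by [].
(* The list is now complete and decides whether [v] is ignored, absorbed or kept. *)
have k_all : kept s v = pmap (repl A D) (children (L v)) by rewrite /kept pE take_size.
split; rewrite ?ptrE ?kE //; first by rewrite pE.
- by move=> c /p2 cm; rewrite mE cm if_same.
- move=> o cs Lv; rewrite -(p5 o cs Lv) /s' /= Ec eqxx /=.
  move: (lab0 v); rewrite -/L Lv /= (si (In Kind)) // => -[-> _ _].
  by case: o {Lv} => /=; rewrite muln1 addn0.
move=> _.
have repE : s' Rep v = code (repl A D v).
  rewrite /s' /= Ec eqxx /= NE (si (In Kind)) // (si (In VarOf)) // (si Atom) //.
  rewrite p3 k_all replE // -/L.
  case Lv: (L v) (lab0 v) => [[x b]|o cs]; rewrite -/L Lv /=.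
    by case=> -> -> _; rewrite At !mul0n mul1n !addn0 addn1; case: (x \in A); rewrite ?mul1n ?mul0n.
  case=> -> _ _; have -> : ((if o is Conj then 1 else 2) == 0) = false by case: o {Lv}.
  move: p4; rewrite k_all Lv /=; case: (pmap _ _) => [|w [|w' ws]] //= p4.
    by rewrite !mul0n !mul1n p4 // addn1.
  by rewrite !mul0n mul1n addn0 addn1.
split=> //; try by rewrite /s' /= Ec eqxx /= ?NE ?addn0 ?si.
- move=> w vw; rewrite /s' /= Ec eqxx /= (si (In Kind)) //.
  move: vw; rewrite replE // -/L; case Lv: (L v) (lab0 v) => [[x b]|o cs]; rewrite -/L Lv /=.
    by case=> -> _ _; case: ifP => // _ [<-]; rewrite muln0 tau_valE // -/L Lv.
  case=> -> _ _; rewrite (p5 _ _ Lv) k_all Lv /=.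
  have -> : (0 < if o is Conj then 1 else 2) by case: o {Lv}.
  have -> : ((if o is Conj then 1 else 2) == 0) = false by case: o {Lv}.
  rewrite muln1 addn0; case ws: (pmap _ _) => [|w' [|? ?]] // [<-].
    by case: o {Lv} => /=; rewrite big_seq1.
  by rewrite tau_valE // -/L Lv ws; case: o {Lv}.
have -> : s' Present v = (s' Rep v == v + 1) by rewrite /s' /= Ec !eqxx.
by rewrite repE addn1; case: (repl A D v).
Qed.

Lemma children_stored (s : store) (v : 'I_n) :
  inv s -> s Ptr v < size (children (L v)) ->
  [/\ s (In Kind) v = (if L v is Gate Conj _ then 1 else 2),
      s (In Degree) v = size (children (L v)) &
      s (In Child) (s (In First) v + s Ptr v)
        = nth v (children (L v)) (s Ptr v)].
Proof.
move=> [si _ _ _]; have [_ _ _ /(_ v)] := inD; rewrite -/L.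
rewrite (si (In Kind)) // (si (In Degree)) // (si (In First)) // (si (In Child)) //.
case: (L v) => //= o cs [-> -> chs] pcs; split=> //.
by rewrite chs // (nth_map v).
Qed.

(** The common part of passing an ignored and a remaining child. *)
Lemma advance_inv (s s' : store) (v : 'I_n) st :
  inv s -> on_stack s v st -> s Ptr v < size (children (L v)) ->
  s Mark (nth v (children (L v)) (s Ptr v)) = 2 ->
  (forall a i, is_input a -> s' a i = s a i) ->
  s' Cur =1 s Cur -> s' Mark =1 s Mark -> s' Parent =1 s Parent ->
  (forall a (u : 'I_n), node_array a -> u != v -> s' a u = s a u) ->
  (forall (u : 'I_n) j, j < n -> u != v ->
     s' (Out Child) (u * n + j) = s (Out Child) (u * n + j)) ->
  s' Ptr v = (s Ptr v).+1 ->
  s' (Out Degree) v = size (kept s' v) ->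
  (forall j, j < size (kept s' v) ->
     s' (Out Child) (v * n + j) = nth 0 (map val (kept s' v)) j) ->
  (forall o cs, L v = Gate o cs -> s' Value v = acc o (kept s' v)) ->
  inv s' /\ pot s' < pot s.
Proof.
move=> [si sn sm _] [Ec uq lst pth mk] pv mc s'i cE mE PE s'a s'c ptr' p3 p4 p5.
have takeE : take (s' Ptr v) (children (L v))
    = rcons (take (s Ptr v) (children (L v))) (nth v (children (L v)) (s Ptr v)).
  by rewrite ptr' (take_nth v).
have ptrE (u : 'I_n) : s Ptr u <= s' Ptr u.
  by have [->|uv] := eqVneq u v; [rewrite ptr' | rewrite s'a].
split; last first.
  apply: (@ltn_pot s s' v) => // [u|]; first by rewrite mE.
  by rewrite ptr' ltnSn pv.
split.
- by move=> a i ia; rewrite s'i // si.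
- move=> u; have [->{u}|uv] := eqVneq u v; last first.
    apply: (node_inv_frame (s := s)) => //; last by rewrite mE.
    - by move=> a na; apply: s'a.
    - by move=> j jn; apply: s'c.
    by move=> x; rewrite mE.
  split; rewrite ?ptr' //.
    rewrite -ptr' takeE => c; rewrite mem_rcons inE mE => /predU1P[->//|].
    by have [_ + _ _ _ _] := sn v; apply.
  by move=> m2; move: (mk v); rewrite -mE m2 mem_head.
- by move=> u; rewrite mE.
right; exists v, st; split=> //; first by rewrite cE.
  by apply: sub_path pth => x y; rewrite PE.
by move=> u; rewrite mE.
Qed.

Lemma absorb_inv (s : store) (v : 'I_n) st :
  inv s -> on_stack s v st -> s Ptr v < size (children (L v)) ->
  s Mark (nth v (children (L v)) (s Ptr v)) = 2 ->
  let s' := run (Seq (If (Read Rep cur_child) absorb_child Skip)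
                     (Assign Ptr cur (succ (at_cur Ptr)))) s in
  inv s' /\ pot s' < pot s.
Proof.
move=> Is os pv mc s'; have [kin _ ch] := children_stored Is pv.
have [si sn _ _] := Is; have [Ec _ _ _ _] := os.
set c := nth v _ _ in mc ch.
have [_ _ p3 p4 p5 _] := sn v.
have [_ rc vc _ _ _ _ _] := inv_fin (sn c) mc.
have NE : s NodeCount 0 = n by rewrite si //; case: inD.
have kE (s1 : store) : s1 Ptr v = (s Ptr v).+1 ->
    kept s1 v = if repl A D c is Some w then rcons (kept s v) w else kept s v.
  move=> E; rewrite /kept E (take_nth v) // -cats1 pmap_cat /= -/c.
  by case: (repl A D c) => [w|] /=; rewrite ?cats0 ?cats1.
have s'E : s' =
    let s1 := if repl A D c is Some w then
      update (update (update s Value v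
        (if L v is Gate Conj _ then (s Value v + (s (Out Degree) v == 0)) * s Value c
         else s Value v + s Value c))
        (Out Child) (v * n + s (Out Degree) v) w)
        (Out Degree) v (s (Out Degree) v).+1
      else s in
    update s1 Ptr v (s Ptr v).+1.
  rewrite /s' /= Ec ch rc; case: (repl A D c) => [w|] /=; rewrite ?Ec ?addn1 //.
  rewrite kin NE subn1 /=.
  by case: (L v) => [l|[] cs] /=; rewrite ?mul1n ?mul0n ?add0n ?addn0.
have ptr' : s' Ptr v = (s Ptr v).+1 by rewrite s'E /= eqxx.
have k'E := kE _ ptr'.
(* The next slot still lies in the block of [v]. *)
have kn : size (kept s v) < n.
  apply: leq_trans (size_children v); exact: leq_ltn_trans (size_kept _ _) pv.
apply: (advance_inv Is os) => //; rewrite ?k'E s'E.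
- by move=> a i ia; case: (repl A D c) => [w|]; case: a ia => // -[].
- by case: (repl A D c).
- by case: (repl A D c).
- by case: (repl A D c).
- move=> a u na uv; case: (repl A D c) => [w|] /=; rewrite (neq_val uv) ?andbF //.
  by rewrite node_array_Child ?andbF.
- move=> u j jn uv; case: (repl A D c) => [w|] //=.
  by rewrite p3 (negbTE (slot_neq _ _ uv)).
- by case: (repl A D c) => [w|] //=; rewrite ?eqxx size_rcons p3.
- case: (repl A D c) => [w|] // j.
  rewrite size_rcons ltnS leq_eqVlt map_rcons nth_rcons size_map /= p3 eqn_add2l.
  by case: eqP => [-> _|_ /= jk]; rewrite ?ltnn ?eqxx // jk p4.
move=> o cs Lv; have pE := p5 _ _ Lv.
case cw: (repl A D c) => [w|] //=; rewrite eqxx /= Lv acc_rcons -pE (vc _ cw) p3.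
by case: o {Lv pE}.
Qed.

Lemma push_inv (s : store) (v : 'I_n) st :
  inv s -> on_stack s v st -> s Ptr v < size (children (L v)) ->
  s Mark (nth v (children (L v)) (s Ptr v)) != 2 ->
  inv (run push_child s) /\ pot (run push_child s) < pot s.
Proof.
move=> Is os pv mc; have [_ _ ch] := children_stored Is pv.
have [si sn sm _] := Is; have [Ec uq lst pth mk] := os.
set c := nth v _ _ in mc ch.
have vc : edge L v c by apply: mem_nth.
(* Every node on the stack reaches [v], so an edge from [v] to it would close a cycle. *)
have cst : c \notin v :: st.
  apply: contra (acD vc); rewrite inE => /predU1P[->|]; first exact: connect0.
  have {}pth : path (fun x y => connect (edge L) y x) v st.
    by apply: sub_path pth => x y /andP[/connect1].
  have tr : transitive (fun x y => connect (edge L) y x).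
    by move=> x y z yx zx; apply: connect_trans zx yx.
  by move/(order_path_min tr)/allP: pth; apply.
have mc0 : s Mark c = 0.
  by move: (sm c) mc (mk c); rewrite (negbTE cst); case: (s Mark c) => [|[|[]]].
set s' := run push_child s.
have mE (u : 'I_n) : s' Mark u = if u == c then 1 else s Mark u.
  by rewrite /s' /= Ec ch.
have PE (u : 'I_n) : s' Parent u = if u == c then val v else s Parent u.
  by rewrite /s' /= Ec ch.
split; last first.
  apply: (@ltn_pot s s' c) => [u|u|]; last by rewrite mE eqxx mc0 orbT.
    by rewrite /s' /=.
  by rewrite mE; case: eqP => [->|//]; rewrite mc0.
split; last 2 first.
- by move=> u; rewrite mE; case: ifP.
- right; exists c, (v :: st); split=> //.
  + by rewrite /s' /= Ec ch.
  + by rewrite cons_uniq cst.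
  + rewrite [path _ _ _]/= vc PE eqxx eqxx /=; move: pth.
    apply: (@sub_in_path _ [in v :: st]) => [x y xs _|]; last exact/allP.
    have {}xs : x \in v :: st by [].
    by rewrite PE; have [xc|//] := eqVneq x c; rewrite xc (negbTE cst) in xs.
  by move=> u; rewrite mE in_cons; case: (eqVneq u c) => //= _; rewrite mk.
- by move=> a i ia; rewrite -si // /s' /=; case: a ia => // -[].
move=> u; apply: (node_inv_frame (s := s)) => //.
- move=> a na; rewrite /s' /= node_array_Cur // node_array_Mark //.
  by rewrite node_array_Parent.
- move=> x x2; rewrite mE; case: eqP => // xc; by rewrite xc mc0 in x2.
by rewrite mE; case: eqP.
Qed.

Lemma body_inv s :
  inv s -> expr_eval s unfinished != 0 ->
  inv (run body s) /\ pot (run body s) < pot s.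
Proof.
move=> Is es; have [si sn _ stk] := Is; have [_ R0 _ lab0 _] := inD.
have {es}r2 : s Mark (Defs.root D) < 2.
  by move: es; rewrite /= (si RootIn) // R0 eqb0 negbK.
case: stk => [r2'|[v [st os]]]; first by rewrite r2' in r2.
have [Ec _ _ _ _] := os.
have -> : run body s =
    if s (In Kind) v * (s Ptr v < s (In Degree) v) != 0 then
      if (s Mark (s (In Child) (s (In First) v + s Ptr v)) == 2 : nat) != 0 then
        run (Seq (If (Read Rep cur_child) absorb_child Skip)
                 (Assign Ptr cur (succ (at_cur Ptr)))) s
      else run push_child s
    else run finish_cur s by rewrite -Ec.
have [pv|vp] := ltnP (s Ptr v) (size (children (L v))).
  have [kin deg ch] := children_stored Is pv.
  rewrite deg pv kin ch.
  have -> : (if L v is Gate Conj _ then 1 else 2) * true != 0 by case: (L v) => [l|[]].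
  have [mc|mc] := eqVneq (s Mark (nth v (children (L v)) (s Ptr v))) 2.
    exact: absorb_inv Is os pv mc.
  exact: push_inv Is os pv mc.
have pE : s Ptr v = size (children (L v)) by apply/eqP; rewrite eqn_leq vp inv_ptr.
(* A leaf has kind 0 and a gate has no child left, so the guard fails. *)
suff -> : s (In Kind) v * (s Ptr v < s (In Degree) v) = 0.
  exact: finish_cur_inv Is os pE.
rewrite pE (si (In Kind)) // (si (In Degree)) //; move: (lab0 v); rewrite -/L.
case: (L v) => [[x b] [-> _ _]|o cs [_ -> _]] //=.
by rewrite ltnn muln0.
Qed.

(** * Initial store, final output and total cost *)

Lemma start_inv : inv (run start s0).
Proof.
have [_ R0 _ _ z] := inD; set s := run start s0.
have sE a (u : 'I_n) : node_array a -> s a u = 0.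
  move=> na; rewrite /s /= node_array_Mark // node_array_Cur //= z //.
  by case: a na.
have mE (u : 'I_n) : s Mark u = (u == Defs.root D).
  by rewrite /s /= R0 z // -val_eqE /=; case: eqP.
split.
- by move=> a i; rewrite /s /=; case: a => // -[].
- move=> v; have kE : kept s v = [::] by rewrite /kept sE ?take0.
  split; rewrite ?kE ?(sE Ptr) ?(sE (Out Degree)) ?take0 //.
    by case=> cs _; rewrite sE //= big_nil.
  by rewrite mE; case: eqP.
- by move=> u; rewrite mE; case: eqP.
right; exists (Defs.root D), [::]; split=> //.
by move=> u; rewrite mE inE eqb1.
Qed.

Lemma write_root_output s :
  inv s -> s Mark (Defs.root D) = 2 -> output_store (tau A D) (run write_root s).
Proof.
move=> [si sn _ _] r2; have [_ R0 _ lab0 _] := inD; have [_ rD _] := dagD.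
(* The mark 2 spreads from the root: the pointer of a finished node is past all its children, and
   these are finished. *)
have m2 (v : 'I_n) : s Mark v = 2.
  case/connectP: (rD v) => p; elim/last_ind: p v => [|p w IH] v; first by move=> _ ->.
  rewrite rcons_path last_rcons => /andP[/IH m2 uw] ->.
  have {}m2 := m2 _ (erefl _); have [_ mc _ _ _ fin] := sn (last (Defs.root D) p).
  by apply: mc; rewrite (fin_ptr (fin m2)) take_size.
have fin v := inv_fin (sn v) (m2 v).
have kE v : kept s v = pmap (repl A D) (children (L v)).
  by rewrite /kept (fin_ptr (fin v)) take_size.
split.
- by move=> v; rewrite /= inE (fin_present (fin v)).
- move=> v; rewrite inE => /eqP vv; split; first exact: fin_value (fin v) _ vv.
  have [_ _ _ _ f5 f6 f7 f8] := fin v; have [_ _ p3 p4 _ _] := sn v.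
  move: (lab0 v) p3 p4; rewrite kE /= /tau_label -/L.
  case: (L v) => [[x b] [k0 x0 b0] _ _|o cs [k0 d0 c0] p3 p4] /=.
    by rewrite f5 f6 f7.
  by rewrite f5 f8 p3; split=> // j /p4.
rewrite /= (si RootIn) // R0 (fin_rep (fin _)).
by case: (repl A D _) => [w|] //=; rewrite subn1.
Qed.

(** Being reachable, every node but the root occurs in some list of children; the total length of
    these lists is the number of edges. *)
Lemma nodes_le_edges : n <= (dag_size D).+1.
Proof.
have [_ rD _] := dagD.
have sub : {subset predC1 (Defs.root D) <= flatten [seq children (L v) | v <- enum 'I_n]}.
  move=> v; rewrite inE => vr; case/connectP: (rD v) => p.
  case/lastP: p => [_ /= vE|p w]; first by rewrite vE eqxx in vr.
  rewrite rcons_path last_rcons => /andP[_ uw] ->.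
  by apply/flatten_mapP; exists (last (Defs.root D) p); rewrite ?mem_enum.
have /subset_leq_card := introT fintype.subsetP sub.
rewrite cardC1 card_ord => le_n.
have le_sz := leq_trans le_n (card_size _).
apply: leq_trans (leqSpred n) _; rewrite ltnS; apply: leq_trans le_sz _.
by rewrite size_flatten /shape -map_comp sumnE big_map big_enum.
Qed.

Lemma start_pot : pot (run start s0) <= dag_size D + 2 * n.
Proof.
rewrite /pot big_split /= leq_add //; first by apply: leq_sum => v _; apply: leq_subr.
rewrite mulnC -[X in X * 2]card_ord -sum_nat_const.
by apply: leq_sum => v _; apply: leq_subr.
Qed.

Lemma compress_correct :
  exists s' t, [/\ exec compress s0 s' t, output_store (tau A D) s' &
    t <= cost start + ((expr_cost unfinished + cost body).+1 * (3 * dag_size D + 2)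
         + (expr_cost unfinished).+1 + cost write_root)].
Proof.
have [_ R0 _ _ _] := inD.
have [t1 ex1 t1P] := exec_run s0 (isT : loop_free start).
have [s2 [t2 [ex2 Is2 es2 t2P]]] :=
  @exec_while unfinished body inv pot _ isT body_inv start_inv.
have r2 : s2 Mark (Defs.root D) = 2.
  have [si _ sm _] := Is2; move: es2; rewrite /= (si RootIn) // R0 => /eqP.
  by rewrite eqb0 -leqNgt => le2; apply/eqP; rewrite eqn_leq sm.
have [t3 ex3 t3P] := exec_run s2 (isT : loop_free write_root).
exists (run write_root s2), (t1 + (t2 + t3)); split.
- exact: ExecSeq ex1 (ExecSeq ex2 ex3).
- exact: write_root_output.
apply: leq_add t1P (leq_add (leq_trans t2P _) t3P).
rewrite leq_add2r leq_mul2l /=.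
apply: leq_trans start_pot _.
(* Two mark changes per node and at most one node more than edges give the bound
   [3 * dag_size D + 2]. *)
apply: (@leq_trans (dag_size D + 2 * (dag_size D).+1)).
  by rewrite leq_add2l leq_mul2l nodes_le_edges.
by move: (dag_size D) => E; lia.
Qed.

End Compress.

Theorem lemma3p2 :
  (forall (P : program) (F : cnf) (n : nat) (D : dag n),
     compiled P F D ->
     graph_val (tau (atoms P) D) = graph_val (counting_graph D))
  /\
  (exists (p : cmd) (c n0 : nat),
     forall (P : program) (F : cnf) (n : nat) (D : dag n) (s : store),
       compiled P F D ->
       input_store (atoms P) D s ->
       n0 <= dag_size D ->
       exists (s' : store) (t : nat),
         [/\ exec p s s' t,
             output_store (tau (atoms P) D) s' &
             t <= c * (2 * dag_size D)]).
Proof.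
split; first exact: compiled_graph_val.
pose b := (expr_cost unfinished + cost body).+1.
pose d := cost start + (expr_cost unfinished).+1 + cost write_root.
(* For [E >= 1] edges, [b * (3 * E + 2) + d] is at most [(5 * b + d) * E]. The threshold 1 excludes
   graphs without edges, where the bound would be 0. *)
exists compress, (5 * b + d), 1 => P F n D s [_ _ [dagD _ _ _] _ _] inD E1.
have [s' [t [ex out tP]]] := compress_correct dagD inD.
exists s', t; split=> //; apply: leq_trans tP _; rewrite -/b.
move: (dag_size D) E1 => E E1.
have -> : cost start + (b * (3 * E + 2) + (expr_cost unfinished).+1 + cost write_root)
    = b * (3 * E + 2) + d by rewrite /d; lia.
clearbody b d; nia.
Qed.
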